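(* Let $a,b,c,d \geq 0$ be integers and let $L=\{1^a,2^b,3^c,4^d\}$ be an admissible multiset. Then $L$ has a realization.
   Context: Multisets: exponents denote multiplicity, so $\{1^a,2^b,3^c,4^d\}$ contains $a$ copies of $1$, $b$ copies of $2$, $c$ copies of $3$ and $d$ copies of $4$. The underlying set of a multiset is the set of its distinct elements. Realizations: $K_v$ is the complete graph on the vertex set $\{0,1,\ldots,v-1\}$. The length of the edge between $x$ and $y$ in $K_v$ is $\ell(x,y)=\min(|x-y|,\,v-|x-y|)$. A realization of a multiset $L$ of size $v-1$ is a Hamiltonian path $[h_1,\ldots,h_v]$ in $K_v$ such that the multiset $\{\ell(h_i,h_{i+1}) : 1\le i\le v-1\}$ equals $L$. Admissibility: a multiset $L$ of size $v-1$ is admissible if its underlying set is contained in $\{1,\ldots,\lfloor v/2\rfloor\}$ and for every divisor $e$ of $v$ the number of multiples of $e$ appearing in $L$ (with multiplicity) is at most $v-e$. *)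

(* Defs.v *)
From mathcomp Require Import all_boot.

Set Implicit Arguments.
Unset Strict Implicit.
Unset Printing Implicit Defensive.

(* Multisets of positive integers are represented by sequences up to perm_eq.
   A multiset L of size v - 1 lives in the complete graph K_v on 'I_v, so v is
   recovered from L. *)
Definition order_of (L : seq nat) : nat := (size L).+1.

Definition multiset1234 (a b c d : nat) : seq nat :=
  nseq a 1 ++ nseq b 2 ++ nseq c 3 ++ nseq d 4.

(* With truncated subtraction, one of the two summands is 0. *)
Definition absdiff (x y : nat) : nat := (x - y) + (y - x).

Definition edge_length (v : nat) (x y : 'I_v) : nat :=
  minn (absdiff x y) (v - absdiff x y).

Definition path_lengths (v : nat) (h : seq 'I_v) : seq nat :=
  if h is x :: s then pairmap (@edge_length v) x s else [::].

(* In a complete graph any two distinct vertices are adjacent, so visiting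
   every vertex exactly once is the only requirement. *)
Definition hamiltonian_path (v : nat) (h : seq 'I_v) : bool :=
  perm_eq h (enum 'I_v).

Definition realization (L : seq nat) (h : seq 'I_(order_of L)) : bool :=
  hamiltonian_path h && perm_eq (path_lengths h) L.
Arguments realization : clear implicits.

Definition admissible (L : seq nat) : Prop :=
  let v := order_of L in
  (forall l : nat, l \in L -> 1 <= l <= v %/ 2) /\
  (forall e : nat, e %| v -> count (fun l => e %| l) L <= v - e).

(* Main.v *)
Require Import Defs.
From mathcomp Require Import all_boot zify.

(** Every admissible multiset is obtained from one of finitely many small
    Hamiltonian paths by an operation that can be repeated for ever.

    Cut the vertices 0, ..., v - 1 between m and m + 1, insert x new vertices
    there, and reroute every edge y -- z over the cut (y <= m < z, its length
    measured without passing through 0) as y -- y + x -- z + x.  The second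
    half keeps the length z - y and the first half has length x.  Edges whose
    short way round passes through 0 keep their length as well, since v grows
    together with the difference of their ends.  If the lower ends y are
    exactly the last x vertices before the cut, each of them once, the vertices
    y + x are exactly the x new ones: the result is again a Hamiltonian path,
    with x additional edges of length x ([growing_add]).  The condition survives
    the operation, at the same cut and at every other cut ([growable_grow]), so
    a path that can be grown by every x in a set X yields realizations for its
    own lengths plus any multiple of x edges of length x, for all x in X at once.

    For lengths 1, 2, 3, 4, the vectors (a, b, c, d) reached from one path form
    a cone: coordinate x is fixed, or runs through an arithmetic progression of
    step x.  The cones of the paths in [seeds] cover what is needed.  Only
    finitely many vectors have to be inspected: once coordinate x is large, it
    can be lowered by a multiple of x without affecting admissibility
    ([feasible_trim]), and the cone is then required to be infinite in that
    direction ([fits]).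

    The vectors with a = c = 0 < d escape this scheme, because no path with
    lengths 2 and 4 only can be grown both by 2 and by 4.  Indeed v is odd, so
    division by 2 modulo v turns the lengths into 1 and 2; a cut becomes a pair
    of opposite gaps of the circle, each crossed once if the cut grows by 2 and
    twice if it grows by 4, and since the gaps of two cuts alternate the path
    would need four ends.  But the same division reduces (0, b, 0, d) to
    (b, d, 0, 0), which is covered ([realizes_double]). *)

Set Implicit Arguments.
Unset Strict Implicit.
Unset Printing Implicit Defensive.

(** * Hamiltonian paths as sequences of natural numbers *)

Definition span (v x y : nat) : nat := minn (absdiff x y) (v - absdiff x y).
Definition edges (h : seq nat) : seq (nat * nat) := zip h (behead h).
Definition spans (v : nat) (es : seq (nat * nat)) : seq nat :=
  [seq span v e.1 e.2 | e <- es].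
Definition realizes (L h : seq nat) : bool :=
  perm_eq h (iota 0 (size L).+1) && perm_eq (spans (size L).+1 (edges h)) L.

Lemma pairmap_spans v u s : pairmap (span v) u s = spans v (edges (u :: s)).
Proof. by elim: s u => //= w s IHs u; rewrite IHs. Qed.

Lemma realization_of_realizes (L h : seq nat) :
  realizes L h -> exists h' : seq 'I_(order_of L), realization L h'.
Proof.
rewrite /realization /order_of => /andP[hV hE].
have valK : map val (map (@inord (size L)) h) = h.
  rewrite -map_comp -[RHS]map_id; apply/eq_in_map => y.
  by rewrite (perm_mem hV) mem_iota /= => ?; rewrite inordK.
exists (map inord h); apply/andP; split.
  by apply: (perm_map_inj val_inj); rewrite valK val_enum_ord.
apply: perm_trans hE; rewrite -[in X in perm_eq _ X]valK.
case: (map _ h) => [|u s] //=; rewrite -pairmap_spans.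
by elim: s u => //= w s IHs u; rewrite perm_cons; apply: IHs.
Qed.

Lemma realizes_perm L1 L2 h : perm_eq L1 L2 -> realizes L1 h = realizes L2 h.
Proof. by move=> eqL; rewrite /realizes (perm_size eqL) (permPr eqL). Qed.

(** * Growing a path at a cut *)

Definition crosses (m : nat) (e : nat * nat) : bool :=
  minn e.1 e.2 <= m < maxn e.1 e.2.

(** For an edge of length at most K in K_v with 2 K <= v, direct edges are those
    whose length is the difference of their ends; the short way round of the
    others passes through 0. *)
Definition direct (K : nat) (e : nat * nat) : bool := absdiff e.1 e.2 <= K.
Definition lows (K m : nat) (es : seq (nat * nat)) : seq nat :=
  [seq minn e.1 e.2 | e <- es & direct K e && crosses m e].

(** The last condition keeps the cut away from the short way round of the
    edges through 0: inserting vertices there would lengthen them. *)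
Definition growable (K x m : nat) (h : seq nat) : bool :=
  [&& x <= m.+1, m < size h,
      perm_eq (lows K m (edges h)) (iota (m.+1 - x) x)
    & all (fun e => direct K e || crosses m e) (edges h)].

Definition shift (x m y : nat) : nat := if y <= m then y else y + x.

Definition grow_edge (K x m : nat) (e : nat * nat) : seq (nat * nat) :=
  if direct K e && crosses m e then
    [:: (shift x m e.1, minn e.1 e.2 + x); (minn e.1 e.2 + x, shift x m e.2)]
  else [:: (shift x m e.1, shift x m e.2)].

Fixpoint grow (K x m : nat) (h : seq nat) : seq nat :=
  if h is u :: s then
    shift x m u ::
      (if s is w :: _ then [seq y + x | y <- lows K m [:: (u, w)]] else [::])
      ++ grow K x m s
  else [::].

Lemma edges_grow K x m h :
  edges (grow K x m h) = flatten [seq grow_edge K x m e | e <- edges h].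
Proof.
elim: h => //= u [|w s] //= IHs.
rewrite /grow_edge /lows /=; case: ifP => _ /=; rewrite -IHs //.
Qed.

Lemma grow_vertices K x m h :
  perm_eq (grow K x m h)
    ([seq shift x m y | y <- h] ++ [seq y + x | y <- lows K m (edges h)]).
Proof.
elim: h => //= u [|w s] //= IHs; rewrite perm_cons.
rewrite (perm_trans (perm_cat (perm_refl _) IHs)) // /lows /=.
case: ifP => _ //=.
by rewrite perm_sym -cat_cons -(cat1s (minn u w + x)) perm_catCA.
Qed.

Lemma map_shift_iota x m v : m < v ->
  [seq shift x m y | y <- iota 0 v] = iota 0 m.+1 ++ iota (m.+1 + x) (v - m.+1).
Proof.
move=> lt_mv; rewrite -[in LHS](subnKC lt_mv) iotaD map_cat; congr (_ ++ _).
  rewrite -[RHS]map_id; apply/eq_in_map => y; rewrite mem_iota /shift => ?.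
  by case: ifP => //; lia.
rewrite add0n addnC iotaDl; apply/eq_in_map => y; rewrite mem_iota /shift => ?.
by case: ifP; lia.
Qed.

(** The old vertices are shifted off m + 1, ..., m + x, and the rerouted edges
    visit each of these once since their lower ends are m + 1 - x, ..., m. *)
Lemma grow_hamiltonian K x m v h :
  perm_eq h (iota 0 v) -> growable K x m h ->
  perm_eq (grow K x m h) (iota 0 (x + v)).
Proof.
move=> hV /and4P[le_xm lt_mv low_m _].
move: lt_mv; rewrite (perm_size hV) size_iota => lt_mv.
apply: perm_trans (grow_vertices _ _ _ _) _.
apply: perm_trans (perm_cat (perm_map _ hV) (perm_map _ low_m)) _.
rewrite map_shift_iota //.
have ->: [seq y + x | y <- iota (m.+1 - x) x] = iota m.+1 x.
  by rewrite -{2}(subnKC le_xm) iotaDl; apply: eq_map => y; rewrite addnC.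
have ->: x + v = m.+1 + x + (v - m.+1) by lia.
by rewrite -addnA !iotaD -catA perm_cat2l perm_catC.
Qed.

Lemma lows_cons K m e es : lows K m (e :: es) = lows K m [:: e] ++ lows K m es.
Proof. by rewrite /lows /=; case: ifP. Qed.

Lemma perm_eq_pair (p q r s : nat) :
  (p = r /\ q = s) \/ (p = s /\ q = r) -> perm_eq [:: p; q] [:: r; s].
Proof. by case=> -[-> ->] //; rewrite -cat1s perm_catC. Qed.

Lemma shift_le x m y : y <= m -> shift x m y = y.
Proof. by rewrite /shift => ->. Qed.

Lemma shift_gt x m y : m < y -> shift x m y = y + x.
Proof. by move=> lt_my; rewrite /shift leqNgt lt_my. Qed.


Lemma spans_cat v es1 es2 : spans v (es1 ++ es2) = spans v es1 ++ spans v es2.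
Proof. exact: map_cat. Qed.

Lemma absdiffC u w : absdiff u w = absdiff w u.
Proof. exact: addnC. Qed.

Lemma spanC v u w : span v u w = span v w u.
Proof. by rewrite /span absdiffC. Qed.

Lemma span_le v u w : u <= w -> span v u w = minn (w - u) (v - (w - u)).
Proof. by rewrite /span /absdiff -subn_eq0 => /eqP ->. Qed.

Lemma spans_grow_edge K x m v e :
  x <= K -> K.*2 <= v -> span v e.1 e.2 <= K -> direct K e || crosses m e ->
  perm_eq (spans (x + v) (grow_edge K x m e))
          (nseq (size (lows K m [:: e])) x ++ [:: span v e.1 e.2]).
Proof.
case: e => u w le_xK le_Kv; rewrite /grow_edge /lows /direct /crosses /=.
case: ifP => [/andP[]|] /=.
  move=> dir cr le_e _; apply: perm_eq_pair.
  case: (leqP u w) cr dir le_e => leuw /andP[].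
    rewrite /absdiff => leum ltmw dir _; left.
    rewrite (shift_le _ leum) (shift_gt _ ltmw) !span_le; lia.
  rewrite /absdiff => leum ltmw dir _; right.
  rewrite (shift_le _ leum) (shift_gt _ ltmw) [span _ _ (w + x)]spanC.
  by rewrite [span _ (w + x) w]spanC [span _ u w]spanC !span_le; lia.
move=> ncr le_e cov; rewrite perm_sym (_ : span _ _ _ = span v u w) //.
move: ncr le_e cov; wlog: u w / u <= w.
  move=> H; case/orP: (leq_total u w); first exact: H.
  move=> /H; rewrite [span _ w u]spanC [span _ (shift x m w) _]spanC.
  by rewrite minnC maxnC (absdiffC w).
move=> leuw; rewrite /shift /span /absdiff.
case: (leqP u m); case: (leqP w m) => /=; lia.
Qed.

Lemma spans_grow K x m v es :
  x <= K -> K.*2 <= v -> all (fun l => l <= K) (spans v es) ->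
  all (fun e => direct K e || crosses m e) es ->
  perm_eq (spans (x + v) (flatten [seq grow_edge K x m e | e <- es]))
          (nseq (size (lows K m es)) x ++ spans v es).
Proof.
move=> le_xK le_Kv; elim: es => //= e es IHes /andP[le_e le_es] /andP[c_e c_es].
rewrite lows_cons size_cat nseqD spans_cat.
have perm_e := spans_grow_edge le_xK le_Kv le_e c_e.
apply: perm_trans (perm_cat perm_e (IHes le_es c_es)) _.
by rewrite -!catA perm_cat2l perm_catCA.
Qed.

Lemma lows1 K m e : lows K m [:: e] =
  if direct K e && crosses m e then [:: minn e.1 e.2] else [::].
Proof. by rewrite /lows /=; case: ifP. Qed.

(** * Growth preserves growability *)

Lemma direct_shift K x m e :
  x <= K -> direct K e || crosses m e -> direct K e && crosses m e = false ->
  direct K (shift x m e.1, shift x m e.2) = direct K e.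
Proof.
case: e => u w le_xK; rewrite /direct /crosses /absdiff /shift /=.
by case: (leqP u m); case: (leqP w m); lia.
Qed.

Lemma crosses_shift K x m m' e : direct K e -> crosses m e = false ->
  crosses (if m' < m then m' else m' + x) (shift x m e.1, shift x m e.2) =
  crosses m' e.
Proof.
case: e => u w; rewrite /direct /crosses /shift /= => _.
by case: (leqP u m); case: (leqP w m); case: (ltnP m' m); lia.
Qed.

(** A second cut m' moves with the vertices.  If m' < m, an edge over both cuts
    is rerouted through y + x > m > m', so its first half crosses m' with the
    same lower end; if m <= m', it is the second half, with lower end y + x. *)
Lemma lows_grow_edge K x m m' e :
  x <= K -> {in lows K m [:: e], forall y, m < y + x} ->
  direct K e || crosses m e ->
  lows K (if m' < m then m' else m' + x) (grow_edge K x m e)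
    = [seq if m' < m then y else y + x | y <- lows K m' [:: e]].
Proof.
case: e => u w le_xK.
rewrite [lows K m [:: _]]lows1 /grow_edge; case: ifP => /= [/andP[]|ncr].
  rewrite /direct /crosses /= => dir cr gap _.
  have {gap} gap := gap _ (mem_head _ _).
  rewrite lows_cons !lows1 /direct /crosses /=.
  case: (leqP u w) dir cr gap => leuw; rewrite /absdiff => dir;
    move=> /andP[leum ltmw] gap.
    rewrite (shift_le _ leum) (shift_gt _ ltmw).
    by case: (ltnP m' m) => lemm; case: ifP; case: ifP; case: ifP => //=;
       try lia; move=> *; congr [:: _]; lia.
  rewrite (shift_le x leum) (shift_gt x ltmw).
  by case: (ltnP m' m) => lemm; case: ifP; case: ifP; case: ifP => //=;
       try lia; move=> *; congr [:: _]; lia.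
move=> _ cov; rewrite !lows1 (direct_shift le_xK cov ncr).
case dir: (direct K (u, w)) => //=; rewrite dir /= in ncr.
rewrite (crosses_shift x m' dir ncr); move: ncr; rewrite /crosses /shift /=.
case: ifP => //= cr' ncr; congr [:: _]; move: cr' ncr.
by case: (ltnP m' m); case: (leqP u m); case: (leqP w m); lia.
Qed.

Lemma cover_grow_edge K x m m' e :
  x <= K -> direct K e || crosses m e -> direct K e || crosses m' e ->
  all (fun e' => direct K e' || crosses (if m' < m then m' else m' + x) e')
      (grow_edge K x m e).
Proof.
case: e => u w le_xK; rewrite /grow_edge; case ncr: (_ && crosses m _).
  move/andP: ncr => [dir cr] _ _ /=.
  move: dir cr; rewrite /direct /crosses /absdiff /=.
  case: (leqP u w) => leuw dir /andP[leum ltmw];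
    rewrite (shift_le x leum) (shift_gt x ltmw) andbT;
    by apply/andP; split; apply/orP; left; lia.
move=> cov cov' /=; rewrite (direct_shift le_xK cov ncr) andbT.
case dir: (direct K (u, w)) cov cov' => //=; rewrite /crosses /shift /=.
by case: (ltnP m' m); case: (leqP u m); case: (leqP w m); lia.
Qed.

(** This includes m' = m: the rerouted edges leave the last x new vertices over
    the moved cut m + x, so the same cut can be used again. *)
Lemma growable_grow K x m x' m' v h :
  x <= K -> perm_eq h (iota 0 v) ->
  growable K x m h -> growable K x' m' h ->
  growable K x' (if m' < m then m' else m' + x) (grow K x m h).
Proof.
move=> le_xK hV gr gr'.
have szg := perm_size (grow_hamiltonian hV gr); have szh := perm_size hV.
rewrite !size_iota in szg szh.
case/and4P: gr => le_xm lt_mv low_m cov.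
case/and4P: gr' => le_xm' lt_mv' low_m' cov'.
have gap : {in lows K m (edges h), forall y, m < y + x}.
  by move=> y; rewrite (perm_mem low_m) mem_iota; lia.
apply/and4P; split; first by case: ifP; lia.
- by rewrite szg; rewrite szh in lt_mv'; case: ifP; lia.
- rewrite edges_grow.
  have -> : lows K (if m' < m then m' else m' + x)
        (flatten [seq grow_edge K x m e | e <- edges h]) =
      [seq if m' < m then y else y + x | y <- lows K m' (edges h)].
    elim: (edges h) cov gap => //= e es IHes /andP[ce ces] gap.
    rewrite (lows_cons _ m') map_cat -IHes //; last first.
      by move=> y ye; apply: gap; rewrite lows_cons mem_cat ye orbT.
    rewrite -(lows_grow_edge _ le_xK) //; last first.
      by move=> y ye; apply: gap; rewrite lows_cons mem_cat ye.
    by rewrite /lows filter_cat map_cat.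
  apply: perm_trans (perm_map _ low_m') _.
  case: ifP => _; first by rewrite map_id.
  have -> : (m' + x).+1 - x' = x + (m'.+1 - x') by lia.
  by rewrite iotaDl (eq_map (addnC x)).
- rewrite edges_grow; elim: (edges h) cov cov' => //= e es IHes.
  move=> /andP[ce ces] /andP[ce' ces'].
  by rewrite all_cat cover_grow_edge //= IHes.
Qed.

(** * Families of realizations *)

Definition growing (K : nat) (X L : seq nat) : Prop :=
  exists2 h, realizes L h & forall x, x \in X -> exists m, growable K x m h.

Lemma growing_add K X L x :
  all (fun l => l <= K) L -> K.*2 <= (size L).+1 -> x \in X -> x <= K ->
  growing K X L -> growing K X (nseq x x ++ L).
Proof.
move=> le_LK le_Kv Xx le_xK [h /andP[hV hL] hX].
have [m gr] := hX x Xx.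
have szv : (size (nseq x x ++ L)).+1 = x + (size L).+1.
  by rewrite size_cat size_nseq addnS.
exists (grow K x m h).
  rewrite /realizes szv (grow_hamiltonian hV gr) edges_grow /=.
  have /and4P[_ _ low_m cov] := gr.
  apply: perm_trans (spans_grow le_xK le_Kv _ cov) _.
    by rewrite (perm_all _ hL).
  by rewrite (perm_size low_m) size_iota perm_cat2l.
move=> x' /hX[m' gr']; exists (if m' < m then m' else m' + x).
exact: growable_grow hV gr gr'.
Qed.

Lemma growing_addn K X L x k :
  all (fun l => l <= K) L -> K.*2 <= (size L).+1 -> x \in X -> x <= K ->
  growing K X L -> growing K X (nseq (k * x) x ++ L).
Proof.
move=> le_LK le_Kv Xx le_xK gL; elim: k => // k IHk.
rewrite mulSn nseqD -catA; apply: growing_add => //.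
  by rewrite all_cat le_LK andbT all_nseq le_xK orbT.
by rewrite size_cat; lia.
Qed.

(** The size conditions are those of [growing_add]; growth preserves them, so
    that growths by different x can be chained. *)
Definition growable_family (K : nat) (X L : seq nat) : Prop :=
  [/\ growing K X L, all (fun l => l <= K) L & K.*2 <= (size L).+1].

Lemma family_addn K X L x k :
  x <= K -> (x \in X) || (k == 0) ->
  growable_family K X L -> growable_family K X (nseq (k * x) x ++ L).
Proof.
move=> le_xK /orP[Xx|/eqP->] [gL le_LK le_Kv] //; split.
- exact: growing_addn.
- by rewrite all_cat le_LK andbT all_nseq le_xK orbT.
- by rewrite size_cat; lia.
Qed.

(** * From a single path to a cone of vectors *)

(** Paths on fewer than 8 vertices can be grown too, with a smaller K: their
    lengths are at most v / 2, and [growing_add] asks for 2 K <= v. *)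
Definition cap (v : nat) : nat := minn 4 v./2.

Definition certified (h : seq nat) : bool :=
  perm_eq h (iota 0 (size h)) &&
  all (fun l => 0 < l <= 4) (spans (size h) (edges h)).

Definition growths (h : seq nat) : seq nat :=
  [seq x <- iota 1 (cap (size h))
     | has (fun m => growable (cap (size h)) x m h) (iota 0 (size h))].

Lemma certified_family h : 0 < size h -> certified h ->
  growable_family (cap (size h)) (growths h) (spans (size h) (edges h)).
Proof.
move=> h_gt0 /andP[hV hL].
have szL : (size (spans (size h) (edges h))).+1 = size h.
  by rewrite size_map size_zip size_behead; lia.
split; last by rewrite szL /cap; lia.
  exists h; first by rewrite /realizes szL hV perm_refl.
  by move=> x; rewrite mem_filter => /andP[/hasP[m _ gr] _]; exists m.
apply/allP => l Ll; have /andP[_ le_l4] := allP hL l Ll.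
case/mapP: Ll le_l4 => e _ ->; rewrite /cap /span; lia.
Qed.

Lemma perm_multiset1234 L : all (fun l => 0 < l <= 4) L ->
  perm_eq L (multiset1234 (count_mem 1 L) (count_mem 2 L)
                          (count_mem 3 L) (count_mem 4 L)).
Proof.
move=> hL; apply/allP => l; rewrite mem_cat => Ll; apply/eqP => /=.
rewrite /multiset1234 !count_cat !count_nseq /=.
have : 0 < l <= 4.
  case/orP: Ll => [/(allP hL) //|]; rewrite !mem_cat !mem_nseq.
  by do ?case/orP; case/andP => _ /eqP->.
by case: l {Ll} => [|[|[|[|[|]]]]] //=; lia.
Qed.

Lemma multiset1234_addn a b c d i j k l :
  perm_eq (nseq l 4 ++ nseq k 3 ++ nseq j 2 ++ nseq i 1 ++ multiset1234 a b c d)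
          (multiset1234 (a + i) (b + j) (c + k) (d + l)).
Proof.
apply/permP => P; rewrite /multiset1234 !count_cat !count_nseq.
by case: (P 1); case: (P 2); case: (P 3); case: (P 4); lia.
Qed.

(** * Reduction to a finite box *)

(** [f] lists the lengths of a path and the steps by which it can be grown.  A
    value q >= bound stands for all larger values in its class modulo x, so
    only families that are infinite in direction x are accepted for it. *)
Definition fits (x bound q : nat) (f : seq nat * seq nat) : bool :=
  let p := count_mem x f.1 in
  if x \in f.2 then (p <= q) && (x %| q - p) else (p == q) && (q < bound).

(** For x dividing bound, every n >= bound is lowered to the first value from
    bound on in its class modulo x, and smaller n are kept. *)
Definition trim (x bound n : nat) : nat := minn n (bound + n %% x).

Lemma fits_trim x bound n f : 0 < x -> x %| bound ->
  fits x bound (trim x bound n) f ->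
  exists k, n = count_mem x f.1 + k * x /\ (x \in f.2) || (k == 0).
Proof.
move=> x_gt0 /dvdnP[t ->]; rewrite /fits /trim; set p := count_mem x _.
case: ifP => Xx; last by move=> /andP[/eqP-> lt]; exists 0; split => //; lia.
case/andP => le_pq dvd_pq; exists ((n - p) %/ x); split=> //.
have le_pn : p <= n by lia.
rewrite divnK ?subnKC //.
move: dvd_pq; rewrite -!eqn_mod_dvd //.
have [le_n|lt_n] := leqP n (t * x + n %% x); first by [].
by rewrite modnMDl modn_mod.
Qed.

(** Admissibility, made explicit: the multiples of e in the multiset are at most
    v - e exactly if at least e - 1 elements are not multiples of e.  Divisors
    e > 4 of v impose nothing. *)
Definition feasible (a b c d : nat) : bool :=
  let v := (a + b + c + d).+1 in
  [&& (0 < b) ==> (4 <= v), (0 < c) ==> (6 <= v), (0 < d) ==> (8 <= v),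
      (2 %| v) ==> (0 < a + c), (3 %| v) ==> (1 < a + b + d)
    & (4 %| v) ==> (2 < a + b + c)].

(** All bounds are at least 7, so a vector with a lowered coordinate still has
    v >= 8.  Lowering the number of copies of x by a multiple of x preserves
    e %| v for each e dividing x; for the other e the remaining copies of x,
    which are not multiples of e, already suffice. *)
Lemma feasible_trim a b c d : feasible a b c d ->
  feasible (trim 1 7 a) (trim 2 8 b) (trim 3 9 c) (trim 4 8 d).
Proof.
have trimP x t n : 0 < x -> exists k, n = trim x (t * x) n + k * x /\
    ((k == 0) || (t * x <= trim x (t * x) n)).
  move=> x_gt0; rewrite /trim; have [le_n|lt_n] := leqP n (t * x + n %% x).
    by exists 0; split=> //; lia.
  exists (n %/ x - t); split; last by rewrite leq_addr orbT.
  rewrite mulnBl {1}(divn_eq n x); have := divn_eq n x; lia.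
have [i [def_a hi]] := trimP 1 7 a isT; have [j [def_b hj]] := trimP 2 4 b isT.
have [k [def_c hk]] := trimP 3 3 c isT; have [l [def_d hl]] := trimP 4 2 d isT.
rewrite /feasible; move: def_a hi def_b hj def_c hk def_d hl => /=.
move: (trim 1 _ a) (trim 2 _ b) (trim 3 _ c) (trim 4 _ d) => p q r s.
move=> -> hi -> hj -> hk -> hl.
case/and5P=> hb hc hd h2 /andP[h3 h4].
apply/and5P; split; last (apply/andP; split).
- lia.
- lia.
- lia.
- clear -hi hj hk hl h2; lia.
- clear -hi hj hk hl h3; lia.
- clear -hi hj hk hl h4; lia.
Qed.

Lemma admissible_feasible a b c d :
  admissible (multiset1234 a b c d) -> feasible a b c d.
Proof.
have szL : order_of (multiset1234 a b c d) = (a + b + c + d).+1.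
  by rewrite /order_of !size_cat !size_nseq !addnA.
have count_dvd e : count (fun l => e %| l) (multiset1234 a b c d) =
    (e %| 1) * a + ((e %| 2) * b + ((e %| 3) * c + (e %| 4) * d)).
  by rewrite /multiset1234 !count_cat !count_nseq.
have mem x : x \in multiset1234 a b c d =
    [|| (0 < a) && (x == 1), (0 < b) && (x == 2), (0 < c) && (x == 3)
      | (0 < d) && (x == 4)].
  by rewrite !mem_cat !mem_nseq.
case; rewrite szL => hmem hdiv; apply/and5P; split; last (apply/andP; split).
- apply/implyP => b_gt0.
  have /hmem : 2 \in multiset1234 a b c d by rewrite mem b_gt0 /= !orbT.
  lia.
- apply/implyP => c_gt0.
  have /hmem : 3 \in multiset1234 a b c d by rewrite mem c_gt0 /= !orbT.
  lia.
- apply/implyP => d_gt0.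
  have /hmem : 4 \in multiset1234 a b c d by rewrite mem d_gt0 /= !orbT.
  lia.
- apply/implyP => /[dup] /dvdn_leq -/(_ isT) ? /hdiv.
  by rewrite count_dvd /=; lia.
- apply/implyP => /[dup] /dvdn_leq -/(_ isT) ? /hdiv.
  by rewrite count_dvd /=; lia.
- apply/implyP => /[dup] /dvdn_leq -/(_ isT) ? /hdiv.
  by rewrite count_dvd /=; lia.
Qed.

(** * The finitely many paths *)

(** A selection, made greedily by the number of vectors covered, from all
    Hamiltonian paths on at most 11 vertices with lengths at most 4. *)
Definition seeds : seq (seq nat) :=
  [:: [:: 0]; [:: 0; 1]; [:: 0; 1; 3; 2]; [:: 0; 2; 3; 1]; [:: 0; 2; 4; 3; 1];
      [:: 0; 3; 1; 4; 2]; [:: 0; 1; 2; 5; 4; 3]; [:: 0; 1; 3; 4; 5; 2];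
      [:: 0; 3; 1; 2; 5; 4]; [:: 0; 3; 1; 5; 4; 2]; [:: 0; 3; 4; 1; 5; 2];
      [:: 1; 3; 0; 4; 5; 2]; [:: 1; 3; 0; 5; 4; 2]; [:: 1; 3; 5; 2; 0; 4];
      [:: 1; 4; 0; 2; 5; 3]; [:: 1; 4; 0; 3; 5; 2]; [:: 1; 4; 3; 0; 5; 2];
      [:: 1; 4; 5; 0; 3; 2]; [:: 0; 2; 5; 1; 3; 6; 4];
      [:: 0; 3; 4; 1; 6; 5; 2]; [:: 0; 3; 6; 4; 1; 5; 2];
      [:: 0; 4; 1; 5; 2; 6; 3]; [:: 0; 6; 3; 2; 5; 1; 4];
      [:: 1; 4; 0; 2; 5; 6; 3]; [:: 1; 4; 0; 3; 6; 5; 2];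
      [:: 1; 4; 6; 3; 0; 5; 2]; [:: 2; 4; 6; 1; 3; 0; 5];
      [:: 2; 5; 0; 3; 1; 6; 4]; [:: 0; 1; 2; 3; 7; 4; 5; 6];
      [:: 0; 1; 2; 3; 7; 6; 5; 4]; [:: 0; 1; 2; 6; 4; 5; 7; 3];
      [:: 0; 1; 2; 6; 5; 4; 7; 3]; [:: 0; 1; 3; 6; 2; 4; 7; 5];
      [:: 0; 1; 4; 3; 2; 6; 7; 5]; [:: 0; 1; 4; 7; 3; 2; 6; 5];
      [:: 0; 1; 5; 2; 3; 6; 7; 4]; [:: 0; 1; 5; 3; 2; 6; 7; 4];
      [:: 0; 1; 5; 4; 2; 7; 6; 3]; [:: 0; 1; 5; 6; 2; 3; 7; 4];
      [:: 0; 1; 5; 7; 3; 4; 6; 2]; [:: 0; 1; 5; 7; 6; 2; 3; 4];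
      [:: 0; 1; 5; 7; 6; 3; 2; 4]; [:: 0; 1; 7; 6; 2; 3; 5; 4];
      [:: 0; 2; 1; 6; 4; 5; 7; 3]; [:: 0; 2; 4; 3; 1; 5; 7; 6];
      [:: 0; 2; 4; 6; 7; 1; 5; 3]; [:: 0; 2; 5; 7; 4; 1; 6; 3];
      [:: 0; 2; 6; 3; 1; 4; 7; 5]; [:: 0; 2; 6; 7; 5; 3; 1; 4];
      [:: 0; 3; 2; 1; 5; 6; 7; 4]; [:: 0; 3; 4; 6; 7; 1; 5; 2];
      [:: 0; 3; 6; 1; 4; 7; 5; 2]; [:: 0; 3; 6; 2; 4; 7; 5; 1];
      [:: 0; 3; 7; 4; 1; 2; 6; 5]; [:: 0; 4; 1; 2; 5; 7; 6; 3];
      [:: 0; 4; 2; 1; 5; 6; 7; 3]; [:: 0; 4; 2; 1; 5; 7; 6; 3];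
      [:: 0; 4; 6; 2; 1; 5; 7; 3]; [:: 0; 4; 7; 5; 1; 2; 6; 3];
      [:: 0; 5; 1; 6; 2; 3; 7; 4]; [:: 0; 5; 2; 7; 4; 1; 6; 3];
      [:: 0; 6; 1; 5; 2; 3; 7; 4]; [:: 0; 7; 1; 5; 3; 2; 6; 4];
      [:: 0; 7; 3; 2; 5; 1; 6; 4]; [:: 0; 7; 4; 3; 6; 1; 5; 2];
      [:: 0; 7; 6; 2; 1; 5; 4; 3]; [:: 0; 7; 6; 4; 2; 1; 5; 3];
      [:: 0; 7; 6; 5; 1; 2; 4; 3]; [:: 1; 2; 6; 3; 0; 5; 7; 4];
      [:: 1; 3; 5; 7; 4; 0; 6; 2]; [:: 1; 3; 7; 5; 2; 0; 6; 4];
      [:: 1; 4; 0; 2; 5; 7; 6; 3]; [:: 1; 4; 0; 2; 6; 7; 5; 3];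
      [:: 1; 4; 0; 7; 3; 5; 6; 2]; [:: 1; 4; 6; 0; 2; 5; 7; 3];
      [:: 1; 4; 7; 5; 0; 2; 6; 3]; [:: 1; 4; 7; 5; 0; 3; 6; 2];
      [:: 1; 4; 7; 5; 2; 0; 6; 3]; [:: 1; 4; 7; 6; 3; 0; 5; 2];
      [:: 1; 5; 0; 4; 6; 2; 7; 3]; [:: 1; 5; 3; 7; 4; 0; 6; 2];
      [:: 1; 5; 4; 0; 6; 2; 3; 7]; [:: 1; 5; 6; 2; 3; 7; 0; 4];
      [:: 2; 3; 0; 5; 7; 4; 1; 6]; [:: 2; 4; 0; 6; 5; 1; 7; 3];
      [:: 2; 4; 0; 6; 7; 1; 5; 3]; [:: 2; 4; 0; 7; 5; 1; 6; 3];
      [:: 2; 5; 0; 3; 7; 4; 1; 6]; [:: 2; 5; 0; 4; 1; 6; 3; 7];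
      [:: 2; 5; 0; 4; 1; 6; 7; 3]; [:: 2; 5; 1; 6; 0; 3; 7; 4];
      [:: 2; 5; 1; 6; 0; 4; 7; 3]; [:: 2; 5; 1; 6; 3; 0; 7; 4];
      [:: 2; 5; 1; 7; 3; 0; 6; 4]; [:: 2; 5; 7; 1; 4; 0; 6; 3];
      [:: 2; 6; 0; 3; 7; 1; 5; 4]; [:: 2; 6; 1; 5; 0; 3; 7; 4];
      [:: 2; 6; 1; 5; 0; 4; 7; 3]; [:: 2; 6; 4; 0; 5; 1; 7; 3];
      [:: 3; 4; 0; 7; 6; 2; 1; 5]; [:: 3; 7; 4; 0; 5; 1; 2; 6];
      [:: 3; 7; 4; 0; 6; 2; 1; 5]; [:: 3; 7; 6; 2; 1; 4; 0; 5];
      [:: 3; 7; 6; 2; 1; 5; 0; 4]; [:: 4; 6; 2; 0; 5; 1; 3; 7];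
      [:: 4; 7; 3; 1; 5; 0; 2; 6]; [:: 0; 1; 6; 2; 7; 3; 4; 8; 5];
      [:: 0; 1; 7; 4; 3; 6; 2; 8; 5]; [:: 0; 2; 4; 1; 7; 5; 3; 8; 6];
      [:: 0; 2; 4; 8; 6; 5; 7; 3; 1]; [:: 0; 2; 5; 8; 6; 4; 7; 3; 1];
      [:: 0; 2; 6; 1; 5; 8; 3; 7; 4]; [:: 0; 2; 6; 8; 4; 5; 7; 3; 1];
      [:: 0; 2; 6; 8; 7; 3; 1; 5; 4]; [:: 0; 3; 5; 1; 2; 6; 8; 7; 4];
      [:: 0; 3; 6; 2; 1; 5; 8; 7; 4]; [:: 0; 3; 6; 2; 8; 5; 1; 7; 4];
      [:: 0; 3; 6; 8; 2; 5; 1; 7; 4]; [:: 0; 3; 7; 2; 6; 1; 5; 8; 4];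
      [:: 0; 3; 7; 4; 1; 2; 5; 8; 6]; [:: 0; 3; 7; 4; 1; 2; 6; 8; 5];
      [:: 0; 4; 1; 2; 5; 7; 8; 6; 3]; [:: 0; 4; 1; 7; 2; 5; 8; 6; 3];
      [:: 0; 4; 1; 7; 5; 2; 8; 6; 3]; [:: 0; 4; 2; 1; 5; 7; 8; 6; 3];
      [:: 0; 4; 2; 7; 1; 5; 8; 6; 3]; [:: 0; 4; 2; 7; 5; 1; 8; 6; 3];
      [:: 0; 4; 7; 8; 6; 2; 1; 5; 3]; [:: 0; 4; 8; 5; 1; 6; 2; 7; 3];
      [:: 0; 4; 8; 5; 2; 6; 1; 3; 7]; [:: 0; 4; 8; 6; 2; 1; 5; 7; 3];
      [:: 0; 4; 8; 7; 3; 2; 6; 5; 1]; [:: 0; 6; 2; 3; 7; 1; 4; 8; 5];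
      [:: 0; 6; 2; 3; 7; 1; 5; 8; 4]; [:: 0; 7; 2; 5; 3; 1; 8; 6; 4];
      [:: 0; 7; 3; 2; 6; 1; 5; 8; 4]; [:: 0; 7; 3; 5; 8; 4; 1; 6; 2];
      [:: 0; 8; 4; 2; 6; 1; 3; 7; 5]; [:: 1; 3; 0; 6; 8; 4; 7; 5; 2];
      [:: 1; 4; 0; 7; 2; 6; 8; 5; 3]; [:: 1; 5; 0; 4; 8; 6; 2; 3; 7];
      [:: 1; 5; 0; 4; 8; 7; 3; 2; 6]; [:: 1; 5; 7; 0; 4; 2; 8; 6; 3];
      [:: 1; 5; 8; 4; 0; 6; 2; 3; 7]; [:: 1; 5; 8; 4; 7; 3; 0; 6; 2];
      [:: 2; 0; 1; 3; 7; 5; 4; 8; 6]; [:: 2; 3; 1; 8; 6; 4; 0; 7; 5];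
      [:: 2; 4; 0; 6; 1; 5; 8; 7; 3]; [:: 2; 4; 0; 7; 1; 5; 8; 6; 3];
      [:: 2; 4; 0; 7; 5; 1; 3; 6; 8]; [:: 2; 5; 1; 6; 8; 4; 0; 7; 3];
      [:: 2; 5; 1; 7; 3; 0; 6; 8; 4]; [:: 2; 6; 0; 3; 7; 1; 4; 8; 5];
      [:: 2; 6; 0; 4; 8; 5; 1; 7; 3]; [:: 2; 6; 1; 5; 0; 3; 7; 8; 4];
      [:: 2; 6; 1; 5; 0; 4; 8; 7; 3]; [:: 2; 6; 3; 0; 8; 5; 1; 7; 4];
      [:: 2; 6; 8; 1; 4; 0; 5; 7; 3]; [:: 2; 6; 8; 4; 0; 5; 1; 3; 7];
      [:: 2; 6; 8; 4; 0; 5; 1; 7; 3]; [:: 2; 6; 8; 5; 0; 4; 1; 7; 3];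
      [:: 3; 5; 8; 6; 2; 1; 4; 0; 7]; [:: 3; 6; 8; 2; 5; 1; 7; 0; 4];
      [:: 3; 6; 8; 5; 2; 1; 4; 0; 7]; [:: 3; 7; 8; 6; 2; 1; 5; 0; 4];
      [:: 4; 8; 5; 1; 2; 6; 3; 0; 7]; [:: 5; 8; 2; 3; 0; 6; 1; 4; 7];
      [:: 0; 2; 6; 3; 1; 5; 8; 9; 7; 4]; [:: 0; 2; 6; 9; 1; 7; 3; 4; 8; 5];
      [:: 0; 2; 6; 9; 5; 4; 8; 1; 7; 3]; [:: 0; 3; 6; 2; 1; 5; 7; 9; 8; 4];
      [:: 0; 3; 6; 9; 1; 5; 2; 8; 7; 4]; [:: 0; 3; 7; 1; 4; 8; 2; 5; 9; 6];
      [:: 0; 3; 7; 1; 5; 9; 6; 2; 8; 4]; [:: 0; 4; 6; 2; 1; 5; 8; 9; 7; 3];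
      [:: 0; 4; 7; 8; 1; 5; 2; 9; 6; 3]; [:: 0; 4; 7; 9; 3; 6; 2; 8; 1; 5];
      [:: 0; 4; 8; 2; 6; 9; 5; 1; 7; 3]; [:: 0; 4; 8; 7; 3; 2; 6; 9; 5; 1];
      [:: 0; 6; 2; 3; 7; 1; 5; 9; 8; 4]; [:: 0; 6; 2; 8; 4; 5; 9; 1; 7; 3];
      [:: 0; 6; 2; 9; 5; 3; 7; 1; 8; 4]; [:: 0; 6; 2; 9; 5; 4; 8; 1; 7; 3];
      [:: 0; 7; 3; 2; 6; 9; 5; 1; 8; 4]; [:: 0; 8; 1; 4; 7; 3; 2; 6; 9; 5];
      [:: 0; 8; 1; 5; 2; 3; 6; 9; 7; 4]; [:: 0; 8; 1; 5; 9; 6; 2; 3; 7; 4];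
      [:: 0; 8; 4; 1; 7; 3; 5; 9; 6; 2]; [:: 0; 8; 4; 3; 7; 1; 5; 9; 6; 2];
      [:: 0; 9; 5; 3; 7; 1; 4; 8; 6; 2]; [:: 1; 4; 0; 3; 6; 9; 5; 2; 8; 7];
      [:: 1; 4; 0; 8; 6; 2; 3; 7; 9; 5]; [:: 1; 4; 0; 8; 7; 3; 2; 6; 9; 5];
      [:: 1; 4; 8; 0; 2; 6; 3; 5; 9; 7]; [:: 1; 5; 2; 8; 0; 4; 6; 9; 7; 3];
      [:: 1; 5; 8; 0; 4; 2; 3; 7; 9; 6]; [:: 1; 5; 9; 7; 3; 2; 4; 0; 8; 6];
      [:: 1; 5; 9; 7; 3; 2; 6; 8; 0; 4]; [:: 2; 0; 7; 3; 1; 8; 4; 5; 9; 6];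
      [:: 2; 3; 0; 7; 4; 1; 8; 5; 9; 6]; [:: 2; 4; 0; 8; 6; 3; 1; 5; 9; 7];
      [:: 2; 4; 0; 8; 6; 9; 5; 1; 7; 3]; [:: 2; 5; 8; 0; 4; 1; 3; 6; 9; 7];
      [:: 2; 5; 8; 1; 4; 0; 3; 6; 9; 7]; [:: 2; 5; 8; 1; 4; 0; 6; 9; 7; 3];
      [:: 2; 6; 0; 3; 7; 1; 5; 9; 8; 4]; [:: 2; 6; 0; 4; 8; 1; 3; 7; 9; 5];
      [:: 2; 6; 0; 4; 8; 1; 5; 9; 7; 3]; [:: 2; 6; 0; 4; 8; 9; 5; 1; 7; 3];
      [:: 2; 6; 9; 5; 1; 8; 0; 3; 7; 4]; [:: 2; 6; 9; 5; 1; 8; 4; 0; 7; 3];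
      [:: 2; 6; 9; 5; 8; 1; 4; 0; 7; 3]; [:: 3; 6; 9; 2; 5; 8; 1; 4; 0; 7];
      [:: 3; 6; 9; 5; 2; 1; 4; 0; 7; 8]; [:: 3; 6; 9; 5; 2; 8; 1; 4; 0; 7];
      [:: 3; 6; 9; 7; 0; 4; 1; 2; 5; 8]; [:: 3; 6; 9; 7; 0; 4; 1; 8; 2; 5];
      [:: 3; 7; 0; 4; 1; 8; 5; 2; 9; 6];
      [:: 0; 1; 8; 4; 5; 9; 2; 6; 10; 7; 3];
      [:: 0; 3; 7; 10; 2; 6; 9; 5; 1; 8; 4];
      [:: 0; 3; 7; 10; 6; 2; 9; 5; 1; 8; 4];
      [:: 0; 4; 7; 3; 10; 8; 5; 1; 9; 2; 6];
      [:: 0; 4; 8; 1; 3; 7; 10; 6; 2; 9; 5];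
      [:: 0; 4; 8; 1; 5; 9; 2; 6; 10; 7; 3];
      [:: 0; 7; 3; 4; 8; 1; 5; 9; 10; 6; 2];
      [:: 0; 7; 3; 5; 9; 1; 8; 4; 2; 10; 6];
      [:: 0; 7; 10; 2; 6; 3; 4; 8; 1; 9; 5];
      [:: 0; 8; 1; 4; 7; 3; 10; 6; 2; 9; 5];
      [:: 0; 8; 4; 1; 9; 5; 3; 7; 10; 6; 2];
      [:: 0; 9; 5; 1; 8; 4; 3; 7; 10; 6; 2];
      [:: 1; 4; 8; 0; 3; 7; 10; 6; 2; 5; 9];
      [:: 1; 5; 3; 2; 6; 10; 8; 4; 0; 9; 7];
      [:: 1; 5; 3; 4; 8; 10; 6; 2; 0; 9; 7];
      [:: 1; 5; 8; 10; 6; 2; 3; 7; 9; 0; 4];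
      [:: 2; 4; 8; 1; 3; 0; 9; 5; 7; 10; 6];
      [:: 2; 5; 9; 6; 3; 1; 4; 0; 8; 10; 7];
      [:: 2; 6; 9; 5; 1; 8; 0; 4; 3; 10; 7];
      [:: 2; 6; 9; 5; 1; 8; 4; 0; 10; 7; 3];
      [:: 2; 6; 9; 5; 1; 10; 8; 4; 0; 7; 3];
      [:: 2; 6; 10; 0; 4; 8; 1; 5; 9; 7; 3];
      [:: 2; 6; 10; 7; 3; 0; 9; 5; 1; 8; 4];
      [:: 2; 6; 10; 9; 5; 1; 8; 4; 0; 7; 3];
      [:: 3; 4; 0; 7; 10; 6; 2; 9; 5; 1; 8]].

Definition families : seq (seq nat * seq nat) :=
  [seq (spans (size h) (edges h), growths h) | h <- seeds].

(** The values b < 8 + 2, c < 9 + 3, d < 8 + 4, a < 7 + 1 are those that [trim]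
    takes with the bounds 8, 9, 8, 7.  Filtering by one coordinate at a time
    keeps the evaluation short. *)
Definition box_covered (S : seq (seq nat * seq nat)) : bool :=
  all (fun b => let S := filter (fits 2 8 b) S in
  all (fun c => let S := filter (fits 3 9 c) S in
  all (fun d => let S := filter (fits 4 8 d) S in
  all (fun a => feasible a b c d && ((0 < a + c) || (d == 0)) ==>
                has (fits 1 7 a) S)
    (iota 0 8)) (iota 0 12)) (iota 0 12)) (iota 0 10).

Lemma seeds_certified : all (fun h => (0 < size h) && certified h) seeds.
Proof. by vm_compute. Qed.

Lemma seeds_cover_box : box_covered families.
Proof. by vm_compute. Qed.

Lemma box_coveredP S a b c d :
  box_covered S -> feasible a b c d -> (0 < a + c) || (d == 0) ->
  exists2 f, f \in S & [&& fits 1 7 (trim 1 7 a) f, fits 2 8 (trim 2 8 b) f,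
                          fits 3 9 (trim 3 9 c) f & fits 4 8 (trim 4 8 d) f].
Proof.
move=> covS /feasible_trim feas acd.
have trim_mem x t n : 0 < x -> trim x t n \in iota 0 (t + x).
  by move=> x_gt0; rewrite mem_iota /trim; have := ltn_pmod n x_gt0; lia.
have /allP/(_ _ (trim_mem 3 9 c isT)) := allP covS _ (trim_mem 2 8 b isT).
move=> /allP/(_ _ (trim_mem 4 8 d isT)) /allP/(_ _ (trim_mem 1 7 a isT)).
have {}acd : (0 < trim 1 7 a + trim 3 9 c) || (trim 4 8 d == 0).
  by rewrite /trim; lia.
rewrite feas acd => /hasP[f]; rewrite !mem_filter => /and4P[fd fc fb Sf] fa.
by exists f; rewrite ?fa ?fb ?fc.
Qed.

Lemma feasible_realizable a b c d :
  feasible a b c d -> (0 < a + c) || (d == 0) ->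
  exists h, realizes (multiset1234 a b c d) h.
Proof.
move=> feas acd.
have [f /mapP[h sh def_f] /and4P[fa fb fc fd]] :=
  box_coveredP seeds_cover_box feas acd.
have /andP[h_gt0 cert] := allP seeds_certified h sh.
have [i [-> hi]] := fits_trim (isT : 0 < 1) (isT : 1 %| 7) fa.
have [j [-> hj]] := fits_trim (isT : 0 < 2) (isT : 2 %| 8) fb.
have [k [-> hk]] := fits_trim (isT : 0 < 3) (isT : 3 %| 9) fc.
have [l [-> hl]] := fits_trim (isT : 0 < 4) (isT : 4 %| 8) fd.
have fam := certified_family h_gt0 cert.
case/andP: cert => _ /perm_multiset1234.
move: fam hi hj hk hl; rewrite def_f /=; set X := growths h; set L := spans _ _.
move=> fam hi hj hk hl permL.
have le_cap x : x \in X -> x <= cap (size h).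
  by rewrite mem_filter mem_iota add1n ltnS => /and3P[].
have add x n L' : (x \in X) || (n == 0) ->
    growable_family (cap (size h)) X L' ->
    growable_family (cap (size h)) X (nseq (n * x) x ++ L').
  move=> hx fam'; case/orP: (hx) => [/le_cap|/eqP-> //] le_x.
  exact: family_addn.
have [[h' hh' _] _ _] :=
  add 4 l _ hl (add 3 k _ hk (add 2 j _ hj (add 1 i _ hi fam))).
exists h'; rewrite -(realizes_perm _ (multiset1234_addn _ _ _ _ _ _ _ _)).
move: permL.
rewrite -(perm_cat2l (nseq (i * 1) 1)) -(perm_cat2l (nseq (j * 2) 2)).
rewrite -(perm_cat2l (nseq (k * 3) 3)) -(perm_cat2l (nseq (l * 4) 4)).
by move/realizes_perm <-.
Qed.

(** * Multiplying a path by 2 *)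

Lemma edges_map (f : nat -> nat) h :
  edges (map f h) = [seq (f e.1, f e.2) | e <- edges h].
Proof. by elim: h => //= u [|w s] //= <-. Qed.

Lemma edges_mem h e : e \in edges h -> (e.1 \in h) && (e.2 \in h).
Proof.
elim: h => //= u [|w s] //= IHs; rewrite inE => /orP[/eqP->|/IHs /andP[h1 h2]].
  by rewrite !inE !eqxx orbT.
by rewrite in_cons h1 orbT in_cons h2 orbT.
Qed.

(** Multiplication by 2 permutes the residues modulo an odd v, and doubles every
    length that is at most v / 4. *)
Lemma realizes_double L h :
  odd (size L).+1 -> all (fun l => l.*2.*2 <= (size L).+1) L ->
  realizes L h ->
  realizes (map double L) (map (fun y => y.*2 %% (size L).+1) h).
Proof.
rewrite /realizes size_map; set v := (size L).+1 => v_odd hL /andP[hV hE].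
have dbl y : y < v -> y.*2 %% v = if y.*2 < v then y.*2 else y.*2 - v.
  move=> lt_yv; case: ltnP => [/modn_small //|le_v].
  by rewrite -{1}(subnK le_v) modnDr modn_small //; lia.
have lt_v y : y \in h -> y < v by rewrite (perm_mem hV) mem_iota.
apply/andP; split.
  have inj : {in h &, injective (fun y => y.*2 %% v)}.
    move=> y z /lt_v lt_y /lt_v lt_z; rewrite !dbl //.
    by do 2!case: ifP; lia.
  apply: uniq_perm; last 1 first.
  - have sub : {subset map (fun y => y.*2 %% v) h <= iota 0 v}.
      by move=> _ /mapP[y _ ->]; rewrite mem_iota ltn_pmod.
    have [] // := uniq_min_size _ sub.
      by rewrite map_inj_in_uniq // (perm_uniq hV) iota_uniq.
    by rewrite size_map (perm_size hV).
  - by rewrite map_inj_in_uniq // (perm_uniq hV) iota_uniq.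
  - exact: iota_uniq.
apply: perm_trans (perm_map double hE); rewrite edges_map /spans -!map_comp.
rewrite (_ : map _ _ = [seq (span v e.1 e.2).*2 | e <- edges h]) ?perm_refl //.
apply/eq_in_map => -[u w] uw /=.
have /andP[/= /lt_v ltu /lt_v ltw] := edges_mem uw.
have : (span v u w).*2.*2 <= v.
  apply: (allP hL); rewrite -(perm_mem hE).
  exact: (map_f (fun e => span v e.1 e.2) uw).
rewrite /span /absdiff !dbl //.
by do 2!case: ifP; lia.
Qed.

(** * The theorem *)

Theorem theorem4p5 (a b c d : nat)
    (hL : admissible (multiset1234 a b c d)) :
  exists h : seq 'I_(order_of (multiset1234 a b c d)),
    realization (multiset1234 a b c d) h.
Proof.
have feas := admissible_feasible hL => {hL}.
have [acd|] := boolP ((0 < a + c) || (d == 0)).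
  by have [h /realization_of_realizes] := feasible_realizable feas acd.
case: a c feas => [|a] [|c] //; rewrite /feasible /= -lt0n => feas d_gt0.
have [v_ge8 v_odd] : 8 <= (b + d).+1 /\ odd (b + d).+1 by move: feas; lia.
have dbl : map double (multiset1234 b d 0 0) = multiset1234 0 b 0 d.
  by rewrite /multiset1234 /= !cats0 map_cat !map_nseq.
have sz : (size (multiset1234 b d 0 0)).+1 = (b + d).+1.
  by rewrite /multiset1234 !size_cat !size_nseq !addn0.
have feas' : feasible b d 0 0 by rewrite /feasible; lia.
have [h hh] := feasible_realizable feas' (orbT _).
apply: (@realization_of_realizes _ (map (fun y => y.*2 %% (b + d).+1) h)).
rewrite -dbl -sz; apply: realizes_double; rewrite ?sz //.
apply/allP => l; rewrite /multiset1234 !mem_cat !mem_nseq; lia.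
Qed.
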